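(* Let $k$ be a field, $R=k[x_1,\dots,x_n]$, and let $I\subseteq R$ be the edge ideal of a hypergraph $\mathcal H$ on the vertex set $V=\{1,\dots,n\}$. Then $\operatorname{depth} R/I^2>0$ if and only if $\mathcal H$ does not have any 2-saturating set.
   Context: A hypergraph $\mathcal H$ on $V=\{1,\dots,n\}$ is a set of subsets of $V$ (its edges); containments between edges are allowed. For $F\subseteq V$ put $x^F=\prod_{i\in F}x_i$. The edge ideal of $\mathcal H$ is the ideal of $R$ generated by all $x^F$, $F\in\mathcal H$. Depth is taken with respect to the maximal homogeneous ideal $(x_1,\dots,x_n)$; the depth of the zero module is $\infty$. A set $U\subseteq V$ is decomposable in a hypergraph if $U$ can be partitioned into two (possibly empty) disjoint subsets each of which contains an edge of the hypergraph; otherwise $U$ is indecomposable. (So every $U$ is decomposable if $\emptyset$ is an edge.) For $i\in V$ set $\mathcal H(i)=\{F\setminus\{i\}\mid F\in\mathcal H\}$. A set $U\subseteq V$ is a 2-saturating set of $\mathcal H$ if $U$ is indecomposable in $\mathcal H$ and, for every $i\in V$, $U\setminus\{i\}$ is decomposable in $\mathcal H(i)$. *)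

(* Defs.v *)
From HB Require Import structures.
From mathcomp Require Import all_boot all_order all_algebra.
From mathcomp Require Import generic_quotient ring_quotient.
From mathcomp Require Import boolp.
From mathcomp Require Import mpoly.

Set Implicit Arguments.
Unset Strict Implicit.
Unset Printing Implicit Defensive.

Import GRing.Theory.
Local Open Scope ring_scope.
Local Open Scope quotient_scope.

Section Span.
Variables (R : comNzRingType) (V : lmodType R) (S : V -> Prop).

Definition span : {pred V} := fun v =>
  `[< exists2 s : seq (R * V), (forall p, p \in s -> S p.2) &
        v = \sum_(p <- s) p.1 *: p.2 >].

Lemma span_submod_closed : submod_closed span.
Proof.
split=> [|a u v /asboolP[s Ss ->] /asboolP[t St ->]]; apply/asboolP.
  by exists [::] => //; rewrite big_nil.
exists ([seq (a * p.1, p.2) | p <- s] ++ t) => [p|].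
  by rewrite mem_cat => /orP[/mapP[q /Ss Sq ->]|/St].
rewrite big_cat big_map scaler_sumr; congr (_ + _).
by apply: eq_bigr => p _; rewrite scalerA.
Qed.

HB.instance Definition _ :=
  GRing.isSubmodClosed.Build R V span
    (GRing.submod_closed_semi span_submod_closed).

End Span.

(* ring_quotient.v provides quotient rings by proper ideals only; the quotient
   modules below also cover V / V = 0. *)
Section QuotientModule.
Variables (R : comNzRingType) (V : lmodType R) (W : submodClosed V).

(* submodClosed does not inherit from zmodClosed in the library. *)
Definition submod_pred : {pred V} := W.

Lemma submod_pred_zmod_closed : zmod_closed submod_pred.
Proof. exact: GRing.submod_closedB (GRing.submodClosedP W). Qed.

HB.instance Definition _ :=
  GRing.isZmodClosed.Build V submod_pred submod_pred_zmod_closed.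

Definition quot_mod : Type := Quotient.quot submod_pred.

HB.instance Definition _ := GRing.Zmodule.on quot_mod.

Definition quot_scale (a : R) (u : quot_mod) : quot_mod :=
  \pi_(Quotient.quot submod_pred) (a *: repr (u : Quotient.quot submod_pred)).

Lemma quot_scaleE a (v : V) :
  quot_scale a (\pi_(Quotient.quot submod_pred) v) = \pi_(Quotient.quot submod_pred) (a *: v).
Proof.
apply/eqP; rewrite /quot_scale -Quotient.idealrBE -scalerBr.
have: repr (\pi_(Quotient.quot submod_pred) v) - v \in submod_pred.
  by rewrite Quotient.idealrBE reprK.
exact: rpredZ.
Qed.

Lemma quot_mod_pi (u : quot_mod) :
  exists v, u = \pi_(Quotient.quot submod_pred) v.
Proof. by exists (repr (u : Quotient.quot submod_pred)); rewrite reprK. Qed.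

Lemma quot_piD (v w : V) :
  (\pi_(Quotient.quot submod_pred) v : quot_mod)
    + \pi_(Quotient.quot submod_pred) w
  = \pi_(Quotient.quot submod_pred) (v + w).
Proof. by rewrite Quotient.pi_add. Qed.

Lemma quot_scalerA a b u :
  quot_scale a (quot_scale b u) = quot_scale (a * b) u.
Proof. by have [v ->] := quot_mod_pi u; rewrite !quot_scaleE scalerA. Qed.

Lemma quot_scale1r : left_id 1 quot_scale.
Proof. by move=> u; have [v ->] := quot_mod_pi u; rewrite quot_scaleE scale1r. Qed.

Lemma quot_scalerDr : right_distributive quot_scale +%R.
Proof.
move=> a u w; have [v ->] := quot_mod_pi u; have [x ->] := quot_mod_pi w.
by rewrite quot_piD !quot_scaleE quot_piD scalerDr.
Qed.

Lemma quot_scalerDl u : {morph quot_scale^~ u : a b / a + b}.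
Proof.
move=> a b; have [v ->] := quot_mod_pi u.
by rewrite !quot_scaleE quot_piD scalerDl.
Qed.

HB.instance Definition _ := GRing.Zmodule_isLmodule.Build R quot_mod
  quot_scalerA quot_scale1r quot_scalerDr quot_scalerDl.

End QuotientModule.

Section Ideals.
Variable R : comNzRingType.

Definition ideal : Type := submodClosed R^o.

Definition ideal_gen (S : R -> Prop) : ideal := @span R R^o S.

Definition ideal_mul (I J : ideal) : ideal :=
  ideal_gen (fun h => exists f g, [/\ f \in I, g \in J & h = f * g]).

(* R/J as an R-module. *)
Definition quot_ideal (J : ideal) : lmodType R := @quot_mod R R^o J.

End Ideals.

Section Depth.
Variable R : comNzRingType.

Definition zero_module (M : lmodType R) : Prop := forall u : M, u = 0.

Definition nonzerodivisor (M : lmodType R) (x : R) : Prop :=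
  forall u : M, x *: u = 0 -> u = 0.

(* The submodule (x_1, ..., x_r) M. *)
Definition seq_smul (M : lmodType R) (xs : seq R) : submodClosed M :=
  @span R M (fun v => exists2 x, x \in xs & exists u : M, v = x *: u).

Definition regular_seq (M : lmodType R) (xs : seq R) : Prop :=
  (forall i, (i < size xs)%N ->
     nonzerodivisor (quot_mod (seq_smul M (take i xs))) xs`_i) /\
  ~ zero_module (quot_mod (seq_smul M xs)).

(* Extended natural numbers: None is infinity. *)
Definition sup_nat (A : nat -> Prop) : option nat :=
  match pselect (exists b, forall r, A r -> (r <= b)%N) with
  | left bnd => Some (\max_(r < (sval (cid bnd)).+1 | `[< A r >]) (r : nat))%N
  | right _ => None
  end.

Definition lt_enat (m : nat) (d : option nat) : bool :=
  if d is Some e then (m < e)%N else true.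

Definition depth (m : ideal R) (M : lmodType R) : option nat :=
  if `[< zero_module M >] then None
  else sup_nat (fun r => exists xs : seq R,
         [/\ size xs = r, {subset xs <= m} & regular_seq M xs]).

End Depth.

Section Hypergraphs.
Variable n : nat.
Implicit Types (H : {set {set 'I_n}}) (U : {set 'I_n}).

Definition decomposable H U : Prop :=
  exists A B : {set 'I_n},
    [/\ A :|: B = U, [disjoint A & B],
        exists2 F, F \in H & F \subset A &
        exists2 F, F \in H & F \subset B].

Definition del_vertex H (i : 'I_n) : {set {set 'I_n}} :=
  [set F :\ i | F in H].

(* The vertex i ranges over all of V, not only over U. *)
Definition saturating2 H U : Prop :=
  ~ decomposable H U /\
  forall i : 'I_n, decomposable (del_vertex H i) (U :\ i).

Variable k : fieldType.

Definition xmon (F : {set 'I_n}) : {mpoly k[n]} := \prod_(i in F) 'X_i.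

Definition edge_ideal H : ideal {mpoly k[n]} :=
  ideal_gen (fun f => exists2 F, F \in H & f = xmon F).

Definition max_ideal : ideal {mpoly k[n]} :=
  ideal_gen (fun f => exists i : 'I_n, f = 'X_i).

End Hypergraphs.

(* Main.v *)
(** A monomial ideal J satisfies depth R/J = 0 iff some monomial x^a outside J
    is killed modulo J by every variable: otherwise x_1 + ... + x_n is a
    nonzerodivisor on R/J, over any field.  For J = I^2 we have x^a in J iff
    1_F + 1_G <= a for two edges F and G.  A socle monomial of R/I^2 is
    squarefree, because F and G together use each vertex at most twice, so it
    has the form x^U with U indecomposable; such a U is 2-saturating, and
    conversely a maximal indecomposable superset of a 2-saturating set gives a
    socle monomial. *)

Require Import Defs.
From mathcomp Require Import all_boot all_order all_algebra.
From mathcomp Require Import ring_quotient generic_quotient boolp.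
From mathcomp Require Import mpoly.

Set Implicit Arguments.
Unset Strict Implicit.
Unset Printing Implicit Defensive.

Import GRing.Theory.
Local Open Scope ring_scope.
Local Open Scope quotient_scope.

(** * Membership in generated submodules *)

Section Span.
Variables (R : comNzRingType) (V : lmodType R) (S : V -> Prop).

Lemma mem_span v : S v -> v \in Defs.span S.
Proof.
move=> Sv; apply/asboolP; exists [:: (1, v)] => [p|].
  by rewrite inE => /eqP ->.
by rewrite big_seq1 scale1r.
Qed.

Lemma span_ind (P : V -> Prop) :
    P 0 -> (forall a u v, S u -> P v -> P (a *: u + v)) ->
  forall v, v \in Defs.span S -> P v.
Proof.
move=> P0 PD v /asboolP[s + ->]; elim: s => [|p s IHs] Ss.
  by rewrite big_nil.
rewrite big_cons; apply: PD; first by apply: Ss; rewrite mem_head.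
by apply: IHs => q qs; apply: Ss; rewrite inE qs orbT.
Qed.

End Span.

(** * Quotient modules in terms of representatives *)

Section Quotient.
Variables (R : comNzRingType) (V : lmodType R) (W : submodClosed V).

Definition quot_proj (v : V) : quot_mod W :=
  \pi_(Quotient.quot (submod_pred W)) v.

Lemma quot_projZ a v : a *: quot_proj v = quot_proj (a *: v).
Proof. exact: quot_scaleE. Qed.

Lemma quot_projD v w : quot_proj v + quot_proj w = quot_proj (v + w).
Proof. exact: quot_piD. Qed.

Lemma quot_proj_surj (u : quot_mod W) : exists v, u = quot_proj v.
Proof. exact: quot_mod_pi. Qed.

Lemma quot_proj_eq v w : quot_proj v = quot_proj w <-> v - w \in W.
Proof.
change (quot_proj v = quot_proj w <-> v - w \in submod_pred W).
by rewrite Quotient.idealrBE; split=> /eqP.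
Qed.

Lemma quot_proj_eq0 v : quot_proj v = 0 <-> v \in W.
Proof.
have <- : quot_proj 0 = 0 by rewrite -(scale0r 0) -quot_projZ scale0r.
by rewrite quot_proj_eq subr0.
Qed.

Lemma zero_module_quot : zero_module (quot_mod W) <-> forall v, v \in W.
Proof.
split=> h => [v|u]; first by apply/quot_proj_eq0/h.
by have [v ->] := quot_proj_surj u; apply/quot_proj_eq0.
Qed.

Lemma nonzerodivisor_quot x :
  nonzerodivisor (quot_mod W) x <-> forall v, x *: v \in W -> v \in W.
Proof.
split=> h => [v xv|u].
  by apply/quot_proj_eq0/h; rewrite quot_projZ; apply/quot_proj_eq0.
have [v ->] := quot_proj_surj u; rewrite quot_projZ => /quot_proj_eq0 /h xv.
exact/quot_proj_eq0.
Qed.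

End Quotient.

(** * Positive depth as existence of a nonzerodivisor *)

Section Depth.
Variable R : comNzRingType.

(** The value infinity fits in as well: a set without positive members is bounded by 0, so an
    unbounded one has a positive member. *)
Lemma lt0_sup_nat (A : nat -> Prop) :
  lt_enat 0 (sup_nat A) <-> exists2 r, (0 < r)%N & A r.
Proof.
rewrite /sup_nat; case: pselect => [bnd|unbnd] /=; last first.
  split=> // _; apply: contrapT => h; apply: unbnd; exists 0%N => r Ar.
  by rewrite leqNgt; apply/negP => r0; apply: h; exists r.
case: (cid bnd) => b /= hb; split.
  move=> h; apply: contrapT => hA; move: h; rewrite big1 // => r /asboolP Ar.
  by apply/eqP; rewrite -leqn0 leqNgt; apply/negP => r0; apply: hA; exists r.
move=> [r r0 Ar]; have rb : (r < b.+1)%N by rewrite ltnS hb.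
by apply: (leq_trans r0);
  apply: (bigop.bigmax_sup (Ordinal rb)) => //; apply/asboolP.
Qed.

Lemma seq_smul_nil (M : lmodType R) v : v \in seq_smul M [::] -> v = 0.
Proof.
by apply: (span_ind (P := fun v => v = 0)) => // a u w [].
Qed.

(** The first term of a regular sequence is tested on the quotient of [M] by the submodule generated
    by nothing, which is zero. *)
Lemma nonzerodivisor_nil (M : lmodType R) x :
  nonzerodivisor (quot_mod (seq_smul M [::])) x <-> nonzerodivisor M x.
Proof.
rewrite nonzerodivisor_quot; split=> h v.
  by move=> xv; apply/seq_smul_nil/h; rewrite xv rpred0.
by move=> /seq_smul_nil /h ->; rewrite rpred0.
Qed.

(** The case [1 \in J] is the zero module, of depth infinity. Otherwise a nonempty regular sequence
    starts with a nonzerodivisor, and a nonzerodivisor in [m] alone is a regular sequence. *)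
Lemma depth_quot_gt0 (m J : ideal R) :
    1 \notin m -> (1 \notin J -> {subset J <= m}) ->
  lt_enat 0 (depth m (quot_ideal J)) <->
  1 \in J \/ exists2 x, x \in m & forall f, x * f \in J -> f \in J.
Proof.
move=> m1 Jm.
have M0 : zero_module (quot_ideal J) <-> 1 \in J.
  rewrite zero_module_quot; split=> [|J1 v]; first exact.
  by rewrite -[v]mulr1; apply: (rpredZ (v : R) J1).
rewrite /depth; case: asboolP => [/M0|/M0 J1]; first by split=> //; left.
rewrite lt0_sup_nat; split=> [[r r0 [[|x xs] [sz xm [reg _]]]]|[//|[x xm xJ]]].
- by rewrite -sz in r0.
- right; exists x; first by apply: xm; rewrite mem_head.
  have /nonzerodivisor_nil /nonzerodivisor_quot := reg 0%N isT.
  exact.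
exists 1%N => //; exists [:: x]; split=> // [y|].
  by rewrite inE => /eqP ->.
split=> [[|//] _|/zero_module_quot xM].
  exact/nonzerodivisor_nil/nonzerodivisor_quot.
(* If [x] times R/J were all of R/J, then 1 would be congruent modulo [J] to some [f] in [m], and
   the inclusion of [J] in [m] would give [1 \in m]. *)
have /negP := m1; apply.
have [f fm /quot_proj_eq f1] :
    exists2 f, f \in m & @quot_proj R R^o J 1 = @quot_proj R R^o J f.
  move: (xM (@quot_proj R R^o J 1)).
  apply: (span_ind (P := fun v => exists2 f, f \in m & v = @quot_proj R R^o J f)).
    by exists 0; [exact: rpred0 | exact/esym/quot_proj_eq0/rpred0].
  move=> a u v [y /[!inE] /eqP -> [w ->]] [f fm ->].
  have [g ->] := quot_proj_surj w.
  exists (a * x * g + f).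
    by rewrite mulrAC; apply: rpredD => //; apply: (rpredZ (a * g) xm).
  by rewrite (quot_projZ J x g) (quot_projZ J a) quot_projD scalerA.
by rewrite -(subrK f 1) rpredD // Jm //; apply/negP.
Qed.

End Depth.

Lemma ltn_count (T : eqType) (A B : pred T) (s : seq T) u :
  subpred A B -> u \in s -> B u -> ~~ A u -> (count A s < count B s)%N.
Proof.
move=> AB us Bu Au; rewrite !(permP (perm_to_rem us)) /= Bu (negbTE Au) ltnS.
exact: sub_count.
Qed.

(** * Monomial ideals as upward closed sets of exponents *)

Section MonomialIdeal.
Variables (k : fieldType) (n : nat).
Implicit Types (P Q T : pred 'X_{1..n}) (f g : {mpoly k[n]}).

Definition upward_closed P := forall m m' : 'X_{1..n}, P m -> P (m + m')%MM.

Lemma msupp_mulX f (a m : 'X_{1..n}) :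
  m \in msupp ('X_[a] * f) <-> exists2 m', m' \in msupp f & m = (m' + a)%MM.
Proof.
rewrite mulrC (perm_mem (msuppMX f a)); split.
  by move=> /mapP[m' ? ->]; exists m'; rewrite // addmC.
by move=> [m' ? ->]; apply/mapP; exists m'; rewrite // addmC.
Qed.

Lemma all_msuppM P Q T f g :
    (forall m m', P m -> Q m' -> T (m + m')%MM) ->
  all P (msupp f) -> all Q (msupp g) -> all T (msupp (f * g)).
Proof.
move=> PQT /allP Pf /allP Qg; apply/allP => m /msuppM_le.
by move=> /allpairsP[[a b] /= [/Pf Pa /Qg Qb ->]]; apply: PQT.
Qed.

Lemma all_msupp_upMl P f g :
  upward_closed P -> all P (msupp g) -> all P (msupp (f * g)).
Proof.
move=> upP; apply: (all_msuppM (P := predT)); last exact/allP.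
by move=> m m' _ /upP; rewrite addmC.
Qed.

(** Sums create no new monomials, and multiples stay supported on [P] by upward closure, so it
    suffices to check generators. *)
Lemma ideal_gen_all_msupp P (S : {mpoly k[n]} -> Prop) :
    upward_closed P -> (forall f, S f -> all P (msupp f)) ->
  forall f, f \in ideal_gen S -> all P (msupp f).
Proof.
move=> upP SP.
apply: (span_ind (P := fun f : {mpoly k[n]}^o => all P (msupp f))).
  by have /eqP -> : msupp (0 : {mpoly k[n]}) == [::] by rewrite msupp_eq0.
move=> a f g /SP Pf Pg.
apply/allP => m /msuppD_le; rewrite mem_cat => /orP[|/(allP Pg)//].
exact: (allP (all_msupp_upMl a upP Pf)).
Qed.

Lemma mem_ideal_all_msupp P (J : ideal {mpoly k[n]}) f :
  (forall m, P m -> 'X_[m] \in J) -> all P (msupp f) -> f \in J.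
Proof.
move=> PJ /allP Pf; rewrite [f]mpolyE big_seq; apply: rpred_sum => m /Pf /PJ Jm.
by rewrite -mul_mpolyC; apply: (rpredZ _ Jm).
Qed.

(* The witness is a monomial of a multiple of [g] having the fewest monomials
   outside [P]: were ['X_i * h] not supported on [P], it would have fewer still,
   since a monomial of [h] outside [P] of largest degree in ['X_i] cannot
   be cancelled in [(\sum_j 'X_j) * h]. *)
Lemma socle_monomial P g :
    upward_closed P -> ~~ all P (msupp g) ->
    all P (msupp ((\sum_(i < n) 'X_i) * g)) ->
  exists2 a, ~~ P a & forall i, P (a + U_(i))%MM.
Proof.
move=> upP; have [N] := ubnP (count (predC P) (msupp g)).
elim: N g => // N IHN g; rewrite ltnS => cN gP fgP.
have [/forallP XP|/forallPn[i XiP]] :=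
    boolP [forall i : 'I_n, all P (msupp ('X_i * g))].
  move: gP => /allPn[a ga Pa]; exists a => // i.
  by apply: (allP (XP i)); apply/msupp_mulX; exists a.
apply: (IHN ('X_i * g)) => //; last first.
  by rewrite mulrCA all_msupp_upMl.
apply: leq_trans cN.
have [u0 gu0 Pu0] := allPn gP.
have [u [gu Pu umax]] : exists u, [/\ u \in msupp g, ~~ P u &
    forall v : 'X_{1..n}, v \in msupp g -> ~~ P v -> (v i <= u i)%N].
  have exD : exists d, has (fun u : 'X_{1..n} => ~~ P u && (u i == d)) (msupp g).
    by exists (u0 i); apply/hasP; exists u0; rewrite ?Pu0 /=.
  have bD d : has (fun u : 'X_{1..n} => ~~ P u && (u i == d)) (msupp g) ->
      (d <= \max_(u <- msupp g) u i)%N.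
    by move=> /hasP[u gu /andP[_ /eqP <-]]; apply: leq_bigmax_seq.
  case: (ex_maxnP exD bD) => d /hasP[u gu /andP[Pu /eqP ud]] dmax.
  exists u; split=> // v gv Pv; rewrite ud; apply: dmax.
  by apply/hasP; exists v; rewrite ?Pv /=.
(* Any other way to reach this monomial in the product is ['X_j] times some [v] outside [P] with
   [j != i], so that [v i] exceeds [u i]. Hence its coefficient is that of [u] in [g], which is
   nonzero. *)
have PuX : P (u + U_(i))%MM.
  apply: contraT => nP; rewrite -(negbTE nP); apply: (allP fgP).
  rewrite mcoeff_msupp mulr_suml raddf_sum (bigD1 i) //= big1 ?addr0.
    by rewrite mulrC addmC mcoeffMX -mcoeff_msupp.
  move=> j ji; apply/eqP; rewrite mcoeff_eq0; apply/negP => /msupp_mulX[v gv uv].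
  have Pv : ~~ P v by apply: contra nP; rewrite uv; apply: upP.
  have := umax v gv Pv; rewrite leqNgt => /negP; apply.
  move/mnmP: uv => /(_ i); rewrite !mnmDE !mnm1E eqxx (negbTE ji) addn1 addn0.
  by move=> ->.
(* Multiplication by ['X_i] is injective on monomials, so both counts can be taken over [msupp g];
   [u] is lost and upward closure prevents any gain. *)
have -> : count (predC P) (msupp ('X_i * g)) =
          count (fun m => ~~ P (m + U_(i))%MM) (msupp g).
  rewrite mulrC (permP (msuppMX g U_(i))) count_map.
  by apply: eq_count => m /=; rewrite addmC.
apply: (ltn_count _ gu); rewrite /= ?Pu ?PuX // => m /=.
by apply: contra => /upP.
Qed.

End MonomialIdeal.

(** * Socle monomials of the square of the edge ideal *)

Section EdgeIdealSquare.
Variables (k : fieldType) (n : nat).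
Implicit Types (P : pred 'X_{1..n}) (H : {set {set 'I_n}}) (U F G : {set 'I_n}).

Lemma mnm_neq0 (m : 'X_{1..n}) : m != 0%MM -> exists m' i, m = (m' + U_(i))%MM.
Proof.
move=> m0; have /existsP[i mi] : [exists i, m i != 0%N].
  apply: contraR m0 => /existsPn mi; apply/eqP/mnmP => i; rewrite mnm0E.
  by apply/eqP; rewrite -[_ == _]negbK.
by exists (m - U_(i))%MM, i; rewrite submK // lep1mP.
Qed.

Lemma mem_max_ideal (f : {mpoly k[n]}) :
  f \in max_ideal n k <-> all (predC1 0%MM) (msupp f).
Proof.
split.
  apply: ideal_gen_all_msupp => [m m' /= m0|g [i ->]]; last first.
    by rewrite msuppX /= mnm1_eq0.
  by rewrite mnmD_eq0 (negbTE m0).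
apply: mem_ideal_all_msupp => _ /mnm_neq0[m [i ->]]; rewrite mpolyXD.
have Xi : ('X_i : {mpoly k[n]}) \in max_ideal n k by apply: mem_span; exists i.
exact: (rpredZ ('X_[m] : {mpoly k[n]}) Xi).
Qed.

Lemma depth_monomial_gt0 P (J : ideal {mpoly k[n]}) :
    upward_closed P -> (forall f, f \in J <-> all P (msupp f)) ->
  lt_enat 0 (depth (max_ideal n k) (quot_ideal J)) <->
  ~ exists2 a, ~~ P a & forall i, P (a + U_(i))%MM.
Proof.
move=> upP JP.
have supp1 : msupp (1 : {mpoly k[n]}) = [:: 0%MM] by rewrite -mpolyC1 msupp1.
have J1 : 1 \in J <-> P 0%MM by rewrite JP supp1 /= andbT.
rewrite depth_quot_gt0; last first.
- move=> /negP J1' f /JP /allP Pf; apply/mem_max_ideal/allP => m /Pf Pm /=.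
  by apply/eqP => m0; apply/J1'/J1; rewrite -m0.
- by apply/negP => /mem_max_ideal; rewrite supp1 /= eqxx.
split=> [[/J1 P0|[x /mem_max_ideal xm xJ]] [a /negP Pa aP]|noa].
- by apply: Pa; rewrite -[a]add0m; apply: upP.
(* Since [x] has no constant term, every monomial of [x * 'X_[a]] is a multiple of some ['X_i *
   'X_[a]]; so no element of the maximal ideal is a nonzerodivisor. *)
- have /JP : ('X_[a] : {mpoly k[n]}) \in J; last by rewrite msuppX /= andbT.
  apply/xJ/JP; apply: (all_msuppM (P := predC1 0%MM) (Q := pred1 a)) => //.
    move=> _ _ /mnm_neq0[m [i ->]] /eqP ->.
    by rewrite addmC [(m + _)%MM]addmC addmA; apply: upP.
  by rewrite msuppX /= eqxx.
right; exists (\sum_(i < n) 'X_i).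
  by apply: rpred_sum => i _; apply: mem_span; exists i.
move=> f /JP Pxf; apply/JP; apply: contrapT => /negP Pf; apply: noa.
exact: socle_monomial Pxf.
Qed.

(** The boolean [i \in F], read as 0 or 1, is the exponent of ['X_i] in [xmon k F]; the inequality
    is divisibility by that monomial. *)
Definition edge_mon H : pred 'X_{1..n} :=
  fun m => [exists F in H, [forall i, (i \in F) <= m i]%N].

Definition edge_sq_mon H : pred 'X_{1..n} :=
  fun m => [exists F in H, [exists G in H,
    [forall i, (i \in F) + (i \in G) <= m i]%N]].

Lemma edge_monP H (m : 'X_{1..n}) :
  reflect (exists2 F, F \in H & forall i, (i \in F <= m i)%N) (edge_mon H m).
Proof.
apply: (iffP exists_inP) => -[F HF].
  by move=> /forallP Fm; exists F.
by move=> Fm; exists F => //; apply/forallP.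
Qed.

Lemma edge_sq_monP H (m : 'X_{1..n}) :
  reflect (exists F G, [/\ F \in H, G \in H &
             forall i, ((i \in F) + (i \in G) <= m i)%N])
          (edge_sq_mon H m).
Proof.
apply: (iffP exists_inP) => [[F HF /exists_inP[G HG /forallP FG]]|].
  by exists F, G.
move=> [F [G [HF HG FG]]]; exists F => //; apply/exists_inP; exists G => //.
exact/forallP.
Qed.

Lemma upward_closed_edge_mon H : upward_closed (edge_mon H).
Proof.
move=> m m' /edge_monP[F HF Fm]; apply/edge_monP; exists F => // i.
by rewrite mnmDE (leq_trans (Fm i)) ?leq_addr.
Qed.

Lemma upward_closed_edge_sq_mon H : upward_closed (edge_sq_mon H).
Proof.
move=> m m' /edge_sq_monP[F [G [HF HG FG]]]; apply/edge_sq_monP.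
by exists F, G; split=> // i; rewrite mnmDE (leq_trans (FG i)) ?leq_addr.
Qed.

Lemma xmonE F : xmon k F = 'X_[mesym1 F].
Proof.
rewrite /xmon mprodXE; congr 'X_[_]; apply/mnmP => i.
rewrite mnmE mnm_sumE big_mkcond /= (bigD1 i) //= mnm1E eqxx big1 ?addn0 //.
by move=> j ji; case: ifP => //; rewrite mnm1E (negbTE ji).
Qed.

Lemma edge_ideal_msupp H (f : {mpoly k[n]}) :
  f \in edge_ideal k H -> all (edge_mon H) (msupp f).
Proof.
apply: ideal_gen_all_msupp => [|_ [F HF ->]]; first exact: upward_closed_edge_mon.
rewrite xmonE msuppX /= andbT; apply/edge_monP; exists F => // i.
by rewrite mnmE.
Qed.

Lemma mem_edge_ideal_sq H (f : {mpoly k[n]}) :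
  f \in ideal_mul (edge_ideal k H) (edge_ideal k H) <->
  all (edge_sq_mon H) (msupp f).
Proof.
split.
  apply: ideal_gen_all_msupp => [|_ [g [h [/edge_ideal_msupp Pg + ->]]]].
    exact: upward_closed_edge_sq_mon.
  move=> /edge_ideal_msupp; apply: all_msuppM Pg => m m'.
  move=> /edge_monP[F HF Fm] /edge_monP[G HG Gm'].
  by apply/edge_sq_monP; exists F, G; split=> // i; rewrite mnmDE leq_add.
apply: mem_ideal_all_msupp => m /edge_sq_monP[F [G [HF HG FGm]]].
have -> : m = ((m - (mesym1 F + mesym1 G)) + (mesym1 F + mesym1 G))%MM.
  by rewrite submK //; apply/mnm_lepP => i; rewrite mnmDE !mnmE.
rewrite mpolyXD.
have FGI : ('X_[mesym1 F + mesym1 G] : {mpoly k[n]})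
    \in ideal_mul (edge_ideal k H) (edge_ideal k H).
  apply: mem_span; exists (xmon k F), (xmon k G).
  by split; [apply: mem_span; exists F | apply: mem_span; exists G
            | rewrite !xmonE mpolyXD].
exact: (rpredZ _ FGI).
Qed.

(** Exponents of [mesym1 U] are at most 1, so two edges fit below it exactly when they are disjoint
    subsets of [U]. *)
Lemma decomposableE H U : decomposable H U <-> edge_sq_mon H (mesym1 U).
Proof.
split=> [[A [B [<- dAB [F HF FA] [G HG GB]]]]|].
  apply/edge_sq_monP; exists F, G; split=> // i; rewrite mnmE inE.
  have AB_i := disjointFr (x := i) dAB.
  have /implyP := subsetP FA i; have /implyP := subsetP GB i.
  by case: (i \in A) AB_i => [->|_] //; do !case: (i \in _).
move=> /edge_sq_monP[F [G [HF HG FG]]].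
have FU i : (i \in F) ==> (i \in U) && (i \notin G).
  by move: (FG i); rewrite mnmE; do 3!case: (i \in _).
have GU i : (i \in G) ==> (i \in U).
  by move: (FG i); rewrite mnmE; do 3!case: (i \in _).
(* Vertices of [U] in neither edge are put on the side of [G]. *)
exists F, (U :\: F); split.
- by apply/setP => i; rewrite !inE; move: (FU i); do 3!case: (i \in _).
- by rewrite -setI_eq0; apply/eqP/setP => i; rewrite !inE; case: (i \in F).
- by exists F.
exists G => //; apply/subsetP => i Gi; rewrite inE.
by move: (GU i) (FU i); rewrite Gi /= => ->; case: (i \in F).
Qed.

(** Removing [i] from the edges and from [U] only lifts the constraint at coordinate [i]. *)
Lemma decomposable_delE H U i :
  decomposable (del_vertex H i) (U :\ i) <->
  exists F G, [/\ F \in H, G \in H &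
    forall j, j != i -> ((j \in F) + (j \in G) <= (j \in U))%N].
Proof.
rewrite decomposableE; split.
  move=> /edge_sq_monP[_ [_ [/imsetP[F HF ->] /imsetP[G HG ->] FG]]].
  exists F, G; split=> // j ji; move: (FG j).
  by rewrite mnmE !inE ji.
move=> [F [G [HF HG FG]]]; apply/edge_sq_monP.
exists (F :\ i), (G :\ i); split; try exact: imset_f.
by move=> j; rewrite mnmE !inE; case: eqVneq => //= ji; apply: FG.
Qed.

Lemma leq_bool2 (b c : bool) : (b + c <= 2)%N.
Proof. by case: b c => -[]. Qed.

(* A saturating set need not itself give a socle monomial: for [i] outside [U]
   both edges may contain [i]. A maximal indecomposable superset does. *)
Lemma saturating2_socle H :
  (exists U, saturating2 H U) <->
  exists2 a, ~~ edge_sq_mon H a & forall i, edge_sq_mon H (a + U_(i))%MM.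
Proof.
split=> [[U0 [/decomposableE/negP indU0 satU0]]|[a Pa aP]].
  have [U /maxsetP[indU maxU] U0U] :=
    maxset_exists (P := fun U => ~~ edge_sq_mon H (mesym1 U)) indU0.
  (* For [i] in [U] the exponent at [i] becomes 2, enough for any two edges, and the other
     constraints pass from [U0] to [U]. For [i] outside [U] the product is the monomial of [i |: U],
     decomposable by maximality. *)
  exists (mesym1 U) => // i; have [Ui|Ui] := boolP (i \in U).
    have /decomposable_delE[F [G [HF HG FG]]] := satU0 i.
    apply/edge_sq_monP; exists F, G; split=> // j; rewrite mnmDE mnmE mnm1E.
    have [<-|ji] := eqVneq i j; first by rewrite Ui leq_bool2.
    rewrite addn0 (leq_trans (FG j _)) 1?eq_sym //.
    by have := subsetP U0U j; case: (j \in U0) => // ->.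
  have -> : (mesym1 U + U_(i))%MM = mesym1 (i |: U).
    apply/mnmP => j; rewrite mnmDE !mnmE !inE eq_sym.
    by case: eqVneq => [->|]; rewrite ?(negbTE Ui) ?addn0.
  apply: contraT => iU; move: Ui.
  by rewrite -(maxU _ iU (subsetUr _ _)) setU11.
(* If [a i] were at least 2, the edges fitting below [a + U_(i)] would already fit below [a]. *)
have a_le1 i : (a i <= 1)%N.
  rewrite leqNgt; apply: contra Pa => ai.
  have /edge_sq_monP[F [G [HF HG FG]]] := aP i.
  apply/edge_sq_monP; exists F, G; split=> // j; move: (FG j).
  rewrite mnmDE mnm1E; have [<- _|_] := eqVneq i j; last by rewrite addn0.
  exact: leq_trans (leq_bool2 _ _) ai.
pose U := [set i | a i != 0%N].
have aU : a = mesym1 U.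
  by apply/mnmP => i; rewrite mnmE inE; case: (a i) (a_le1 i) => [|[]].
exists U; split=> [/decomposableE|i]; first by rewrite -aU => /(negP Pa).
have /edge_sq_monP[F [G [HF HG FG]]] := aP i.
apply/decomposable_delE; exists F, G; split=> // j ji; move: (FG j).
by rewrite mnmDE mnm1E eq_sym (negbTE ji) addn0 aU mnmE.
Qed.

End EdgeIdealSquare.

Theorem theorem2p2 (k : fieldType) (n : nat) (H : {set {set 'I_n}}) :
  lt_enat 0 (depth (max_ideal n k)
                   (quot_ideal (ideal_mul (edge_ideal k H) (edge_ideal k H))))
  <-> ~ (exists U : {set 'I_n}, saturating2 H U).
Proof.
rewrite saturating2_socle; apply: depth_monomial_gt0.
  exact: upward_closed_edge_sq_mon.
exact: mem_edge_ideal_sq.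
Qed.
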